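(* Let $q_i\geq 2$ for each $i\in[d]$. Then $$\frac12\sum_{i=1}^d (q_i-2) \;\leq\; \mathrm{boxicity}\left(\times_{i=1}^d K_{q_i}\right) \;\leq\; \sum_{i=1}^d q_i$$ and $$\frac12\sum_{i=1}^d (q_i-2) \;\leq\; \mathrm{cubicity}\left(\times_{i=1}^d K_{q_i}\right) \;\leq\; \sum_{i=1}^d q_i\log(n/q_i),$$ where $n=\prod_{i=1}^d q_i$ is the number of vertices in $\times_{i=1}^d K_{q_i}$.
   Context: All graphs are finite, undirected and simple. $[d]=\{1,\ldots,d\}$, the $q_i$ are integers, $K_m$ is the complete graph on $m$ vertices, and logarithms are to base $2$. A $k$-box is a Cartesian product of $k$ closed intervals of $\mathbb{R}$, and a $k$-cube is a Cartesian product of $k$ closed intervals of unit length. A $k$-box ($k$-cube) representation of a graph $G$ is a function $f$ mapping each vertex to a $k$-box ($k$-cube) such that for any two distinct vertices $u,v$, $uv\in E(G)$ if and only if $f(u)\cap f(v)\neq\emptyset$. The boxicity (cubicity) of $G$ is the smallest natural number $k$ (with $0$ allowed; complete graphs have boxicity and cubicity $0$) such that $G$ has a $k$-box ($k$-cube) representation. The direct product $G_1\times G_2$ is the graph on $V(G_1)\times V(G_2)$ in which $(u_1,u_2)$ and $(v_1,v_2)$ are adjacent iff $u_1v_1\in E(G_1)$ and $u_2v_2\in E(G_2)$; $\times_{i=1}^d$ denotes the iterated direct product, in which two $d$-tuples are adjacent iff they are adjacent in every coordinate.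
   Formalization: Both lower bounds are stated only for d ≥ 2 (they fail for d = 1, q_1 ≥ 3, where the graph is complete), and in the cubicity upper bound log(n/q_i) is replaced by its ceiling, since the unrounded bound fails, e.g. for d = 2, q_1 = q_2 = 98304. *)

(* Defs.v *)
From mathcomp Require Import all_boot all_order all_algebra.
From mathcomp Require Import lra.
From mathcomp Require Import boolp classical_sets reals exp.

Set Implicit Arguments.
Unset Strict Implicit.
Unset Printing Implicit Defensive.

Import Order.TTheory GRing.Theory Num.Theory.
Local Open Scope classical_set_scope.
Local Open Scope ring_scope.

Record sgraph := SGraph {
  vertex :> finType;
  adj : rel vertex;
  adj_sym : symmetric adj;
  adj_irr : irreflexive adj }.

Section Complete.
Variable m : nat.
Let e : rel 'I_m := fun x y => x != y.

Lemma complete_sym : symmetric e.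
Proof. by move=> x y; rewrite /e eq_sym. Qed.

Lemma complete_irr : irreflexive e.
Proof. by move=> x; rewrite /e eqxx. Qed.

Definition complete_graph := SGraph complete_sym complete_irr.
End Complete.

Section DirectProduct.
Variables (d : nat) (G : 'I_d -> sgraph).
Let V : finType := {dffun forall i : 'I_d, G i}.

(* The conjunct [x != y] only matters for [d = 0], where it removes the loop
   on the unique 0-tuple; see [adj_direct_prodE]. *)
Let e : rel V := fun x y => (x != y) && [forall i, adj (x i) (y i)].

Lemma direct_prod_sym : symmetric e.
Proof.
move=> x y; rewrite /e eq_sym; congr (_ && _).
by apply: eq_forallb => i; rewrite adj_sym.
Qed.

Lemma direct_prod_irr : irreflexive e.
Proof. by move=> x; rewrite /e eqxx. Qed.

Definition direct_prod := SGraph direct_prod_sym direct_prod_irr.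

Lemma adj_direct_prodE : (0 < d)%N -> forall x y : direct_prod,
  adj x y = [forall i, adj ((x : V) i) ((y : V) i)].
Proof.
move=> d0 x y; rewrite [LHS]/= /e; case: eqP => // ->.
by apply/esym/negbTE/forallPn; exists (Ordinal d0); rewrite adj_irr.
Qed.
End DirectProduct.

Lemma card_direct_prod_complete d (q : 'I_d -> nat) :
  #|direct_prod (fun i => complete_graph (q i))| = (\prod_(i < d) q i)%N.
Proof.
rewrite card_dep_ffun /= foldrE big_map big_enum /=.
by apply: eq_bigr => i _; rewrite card_ord.
Qed.

Section Representations.
Variable R : realType.

Definition is_box k (B : set 'rV[R]_k) :=
  exists a b : 'rV[R]_k, (forall j, a 0 j <= b 0 j) /\
    B = [set x | forall j, a 0 j <= x 0 j <= b 0 j].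

Definition is_cube k (B : set 'rV[R]_k) :=
  exists a : 'rV[R]_k, B = [set x | forall j, a 0 j <= x 0 j <= a 0 j + 1].

Definition represents (G : sgraph) k (f : G -> set 'rV[R]_k) :=
  forall u v : G, u != v -> (adj u v <-> f u `&` f v !=set0).

Definition box_representation (G : sgraph) k (f : G -> set 'rV[R]_k) :=
  (forall u, is_box (f u)) /\ represents f.

Definition cube_representation (G : sgraph) k (f : G -> set 'rV[R]_k) :=
  (forall u, is_cube (f u)) /\ represents f.

Lemma cube_is_box k (B : set 'rV[R]_k) : is_cube B -> is_box B.
Proof.
move=> [a ->]; exists a, (\row_j (a 0 j + 1)); split=> [j|].
  by rewrite mxE lerDl.
by apply/seteqP; split=> x /= h j; have := h j; rewrite mxE.
Qed.

(* One coordinate per vertex [w], with left endpoint 0 at [w], 1 at the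
   neighbours of [w] and 2 at its non-neighbours. *)
Lemma cube_representation_exists (G : sgraph) :
  exists k, exists f : G -> set 'rV[R]_k, cube_representation f.
Proof.
pose l (u w : G) : R := if u == w then 0 else if adj u w then 1 else 2.
pose a (u : G) : 'rV[R]_#|G| := \row_j l u (enum_val j).
exists #|G|, (fun u => [set x | forall j, a u 0 j <= x 0 j <= a u 0 j + 1]).
split=> [u|u v uv]; first by exists (a u).
split=> [Auv|].
  have near w : (l u w <= l v w + 1) && (l v w <= l u w + 1).
    rewrite /l; have [<-|_] := eqVneq u w.
      by rewrite eq_sym (negbTE uv) adj_sym Auv; lra.
    have [<-|_] := eqVneq v w; first by rewrite Auv; lra.
    by case: (adj u w); case: (adj v w); lra.
  exists (\row_j Num.max (a u 0 j) (a v 0 j)).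
  split=> j /=; rewrite !mxE le_max ge_max !lexx ?orbT /=;
    by have /andP[? ?] := near (enum_val j); rewrite lerDl ler01 ?andbT.
move=> [x [/(_ (enum_rank u)) /= + /(_ (enum_rank u)) /=]].
rewrite !mxE enum_rankK /l eqxx eq_sym (negbTE uv) adj_sym.
by case: (adj u v) => // /andP[_ xu] /andP[vx _]; exfalso; lra.
Qed.

Lemma box_dimension_exists (G : sgraph) :
  exists k, `[< exists f : G -> set 'rV[R]_k, box_representation f >].
Proof.
have [k [f [fc fr]]] := cube_representation_exists G.
exists k; apply/asboolP; exists f; split=> // u; exact: cube_is_box.
Qed.

Lemma cube_dimension_exists (G : sgraph) :
  exists k, `[< exists f : G -> set 'rV[R]_k, cube_representation f >].
Proof.
by have [k kP] := cube_representation_exists G; exists k; apply/asboolP.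
Qed.

Definition boxicity (G : sgraph) : nat := ex_minn (box_dimension_exists G).
Definition cubicity (G : sgraph) : nat := ex_minn (cube_dimension_exists G).

Definition log2 (x : R) : R := ln x / ln 2.

End Representations.

(* Main.v *)
(** Lower bound: take vertices [x], [y] that differ in every coordinate and, for
    each coordinate [i] and each value [a] other than [x i], [y i], the pair
    [u], [v] obtained from [x], [y] by putting [a] in coordinate [i].  Such a
    pair is non-adjacent, but the [u] of a pair is adjacent to the [v] of every
    other pair.  If two of these pairs were separated in the same coordinate of
    a box representation with [u] on the same side, then the four endpoints
    would form a cycle of inequalities; so each coordinate separates at most
    two of the pairs.

    Upper bounds: the non-edges of the product are the pairs inside the sets of
    vertices whose [i]-th entry is [a].  For boxes, one coordinate per [(i, a)]
    places the vertices of this set at distinct points and gives every other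
    vertex an interval containing all of them.  For cubes, the vertices of the
    set, [n / q i] in number, receive distinct binary words, and one coordinate
    per letter puts the words with this letter 0 at [[0, 1]], those with
    letter 1 at [[2, 3]] and all other vertices at [[1, 2]]. *)
Require Import Defs.
From mathcomp Require Import all_boot all_order all_algebra.
From mathcomp Require Import lra.
From mathcomp Require Import boolp classical_sets reals exp.
Import Order.TTheory GRing.Theory Num.Theory.
Local Open Scope ring_scope.

Section Representations.
Set Implicit Arguments.
Unset Strict Implicit.
Variables (R : realType) (G : sgraph).

Lemma boxes_meetP k (a b a' b' : 'rV[R]_k) :
  (forall j, a 0 j <= b 0 j) -> (forall j, a' 0 j <= b' 0 j) ->
  (([set x : 'rV[R]_k | forall j, a 0 j <= x 0 j <= b 0 j] `&`
    [set x : 'rV[R]_k | forall j, a' 0 j <= x 0 j <= b' 0 j])%classic !=set0)%classic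
  <-> forall j, (a 0 j <= b' 0 j) && (a' 0 j <= b 0 j).
Proof.
move=> ab ab'; split=> [[x [/= h h']] j|h].
  have /andP[? ?] := h j; have /andP[? ?] := h' j.
  by apply/andP; split; lra.
exists (\row_j Num.max (a 0 j) (a' 0 j)).
split=> j /=; rewrite mxE le_max ge_max lexx ?orbT /=;
  have /andP[h1 h2] := h j; by rewrite ?ab ?ab' ?h1 ?h2.
Qed.

(** Lets the coordinates be indexed by any finite type, such as the pairs [(i, a)]. *)
Lemma boxicity_le_card (I : finType) (l r : G -> I -> R) :
  (forall u i, l u i <= r u i) ->
  (forall u v, u != v ->
    adj u v <-> forall i, (l u i <= r v i) && (l v i <= r u i)) ->
  (boxicity R G <= #|I|)%N.
Proof.
move=> lr lrE; rewrite /boxicity; case: ex_minnP => k _; apply.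
apply/asboolP.
pose a (u : G) : 'rV[R]_#|I| := \row_j l u (enum_val j).
pose b (u : G) : 'rV[R]_#|I| := \row_j r u (enum_val j).
have ab u j : a u 0 j <= b u 0 j by rewrite !mxE.
exists (fun u => [set x | forall j, a u 0 j <= x 0 j <= b u 0 j])%classic.
split=> [u|u v uv]; first by exists (a u), (b u).
apply: (iff_trans (lrE u v uv)); apply: iff_trans (iff_sym (boxes_meetP _ _)) => //.
split=> h j; first by rewrite !mxE.
by have := h (enum_rank j); rewrite !mxE enum_rankK.
Qed.

Lemma cubicity_le_card (I : finType) (l : G -> I -> R) :
  (forall u v, u != v ->
    adj u v <-> forall i, (l u i <= l v i + 1) && (l v i <= l u i + 1)) ->
  (cubicity R G <= #|I|)%N.
Proof.
move=> lE; rewrite /cubicity; case: ex_minnP => k _; apply.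
apply/asboolP.
pose a (u : G) : 'rV[R]_#|I| := \row_j l u (enum_val j).
pose b (u : G) : 'rV[R]_#|I| := \row_j (a u 0 j + 1).
have ab u j : a u 0 j <= b u 0 j by rewrite [b u 0 j]mxE lerDl.
exists (fun u => [set x | forall j, a u 0 j <= x 0 j <= b u 0 j])%classic.
split=> [u|u v uv].
  by exists (a u); apply/seteqP; split=> x /= h j; have := h j; rewrite [b u 0 j]mxE.
apply: (iff_trans (lE u v uv)); apply: iff_trans (iff_sym (boxes_meetP _ _)) => //.
split=> h j; first by rewrite !mxE.
by have := h (enum_rank j); rewrite !mxE enum_rankK.
Qed.

Lemma boxicity_le_cubicity : (boxicity R G <= cubicity R G)%N.
Proof.
rewrite /cubicity; case: ex_minnP => k /asboolP [f [fc fr]] _.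
rewrite /boxicity; case: ex_minnP => m _; apply.
by apply/asboolP; exists f; split=> // u; apply: cube_is_box.
Qed.

(** Pigeonhole: each [s] is sent to a coordinate and a side on which its pair is separated. This map
    is injective, with [2 * k] possible values. *)
Lemma card_le_boxicity (S : finType) (u v : S -> G) :
  (forall s, u s != v s) -> (forall s, ~~ adj (u s) (v s)) ->
  (forall s t, s != t -> adj (u s) (v t)) ->
  (#|S| <= 2 * boxicity R G)%N.
Proof.
move=> uv nadj cross; rewrite /boxicity.
case: ex_minnP => k /asboolP [f [fb fr]] _.
have [a /choice [b ab]] := choice fb.
have lr w j : a w 0 j <= b w 0 j by have [] := ab w.
have adjE w z : w != z ->
    adj w z <-> forall j, (a w 0 j <= b z 0 j) && (a z 0 j <= b w 0 j).
  move=> wz; apply: (iff_trans (fr w z wz)).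
  by have [_ ->] := ab w; have [_ ->] := ab z; apply: boxes_meetP.
have sep s : exists p : bool * 'I_k,
    if p.1 then b (u s) 0 p.2 < a (v s) 0 p.2
    else b (v s) 0 p.2 < a (u s) 0 p.2.
  have : ~~ [forall j, (a (u s) 0 j <= b (v s) 0 j) && (a (v s) 0 j <= b (u s) 0 j)].
    by apply: contra (nadj s) => /forallP h; apply/(adjE _ _ (uv s)).
  case/forallPn => j; rewrite negb_and -!ltNge => /orP[h|h].
    by exists (false, j).
  by exists (true, j).
have [p pP] := choice sep.
have p_inj : injective p.
  move=> s t pst; apply/eqP; apply: contraT => st.
  have ts : t != s by rewrite eq_sym.
  have meet s' t' : s' != t' -> forall j,
      (a (u s') 0 j <= b (v t') 0 j) && (a (v t') 0 j <= b (u s') 0 j).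
    move=> st'; apply/adjE; last exact: cross.
    (* If the two vertices were equal, [cross] would give a loop. *)
    by apply/eqP => e; have := cross _ _ st'; rewrite e adj_irr.
  have /andP[h1 h2] := meet _ _ st (p s).2.
  have /andP[h3 h4] := meet _ _ ts (p s).2.
  (* With [p.1] true the cycle is [b (u s) < a (v s) <= b (u t) < a (v t) <= b (u s)]; otherwise [u]
     and [v] are exchanged. *)
  have := pP s; have := pP t; rewrite -pst.
  by case: (p s).1; lra.
by have := leq_card p p_inj; rewrite card_prod card_bool card_ord.
Qed.

End Representations.

Section CompleteFactors.
Set Implicit Arguments.
Unset Strict Implicit.
Variables (d : nat) (q : 'I_d -> nat).
Let G := direct_prod (fun i => complete_graph (q i)).
Let V : finType := {dffun forall i : 'I_d, complete_graph (q i)}.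

Lemma adj_completeE (x y : G) : x != y ->
  adj x y = [forall i, (x : V) i != (y : V) i].
Proof. by move=> xy; rewrite /= xy. Qed.

Lemma boxicity_complete_prod_le (R : realType) :
  (boxicity R G <= \sum_(i < d) q i)%N.
Proof.
pose I : finType := {i : 'I_d & 'I_(q i)}.
have -> : (\sum_(i < d) q i)%N = #|I|.
  rewrite card_tagged sumnE big_map big_enum /=.
  by apply: eq_bigr => i _; rewrite card_ord.
pose l (u : G) (p : I) : R :=
  if (u : V) (tag p) == tagged p then (enum_rank u)%:R else 0.
pose r (u : G) (p : I) : R :=
  if (u : V) (tag p) == tagged p then (enum_rank u)%:R else #|G|%:R.
apply: (@boxicity_le_card R G I l r) => [u p|u v uv].
  by rewrite /l /r; case: ifP => // _; rewrite ler0n.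
rewrite adj_completeE //; split=> [/forallP h p|h].
  have le (w : G) : (enum_rank w)%:R <= #|G|%:R :> R.
    by rewrite ler_nat ltnW.
  rewrite /l /r; case: eqP => [eu|_]; case: eqP => [ev|_]; rewrite ?lexx ?ler0n ?le //.
  by have := h (tag p); rewrite eu ev eqxx.
apply/forallP => i; apply: contraNN uv => /eqP e.
(* In the coordinate of a shared entry, [u] and [v] are single points, which meet only if their
   ranks agree. *)
have := h (Tagged (fun i => 'I_(q i)) ((u : V) i)).
rewrite /l /r /= e eqxx -eq_le eqr_nat.
by move/eqP/val_inj/enum_rank_inj->.
Qed.

Definition slice (i : 'I_d) (a : 'I_(q i)) : {set V} := [set x : V | x i == a].

Lemma card_slice i (a : 'I_(q i)) :
  (q i * #|slice a|)%N = (\prod_(j < d) q j)%N.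
Proof.
(* A slice is a product of one singleton and full factors; comparing in [nat] avoids a cast from
   ['I_(q j)] to ['I_(q i)]. *)
pose F (j : 'I_d) : pred (complete_graph (q j)) :=
  fun y : 'I_(q j) => (j == i) ==> (y == a :> nat).
have -> : #|slice a| = #|(family F : simpl_pred V)|.
  apply: eq_card => x; rewrite inE; apply/eqP/familyP => [xa j|/(_ i)].
    by apply/implyP => /eqP->; rewrite xa.
  by rewrite unfold_in eqxx /= => /eqP/val_inj.
rewrite card_family foldrE big_map big_enum /= (bigD1 i) //= [RHS](bigD1 i) //=.
rewrite (_ : #|F i| = 1%N) ?mul1n.
  congr (_ * _)%N; apply: eq_bigr => j /negbTE ji.
  by rewrite -[RHS]card_ord; apply: eq_card => y; rewrite unfold_in ji.
by rewrite -(card1 a); apply: eq_card => y; rewrite unfold_in eqxx.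
Qed.

Lemma cubicity_complete_prod_le (R : realType) (L : 'I_d -> nat) :
  (forall i (a : 'I_(q i)), #|slice a| <= 2 ^ L i)%N ->
  (cubicity R G <= \sum_(i < d) q i * L i)%N.
Proof.
move=> hL.
pose I : finType := {i : 'I_d & ('I_(q i) * 'I_(L i))%type}.
have -> : (\sum_(i < d) q i * L i)%N = #|I|.
  rewrite card_tagged sumnE big_map big_enum /=.
  by apply: eq_bigr => i _; rewrite card_prod !card_ord.
(* The position of [x] in the slice selects its word; [hL] keeps it in range for [x] in the slice,
   so the default is not returned there. *)
pose word (i : 'I_d) (a : 'I_(q i)) (x : V) : {ffun 'I_(L i) -> bool} :=
  nth [ffun=> false] (enum {ffun 'I_(L i) -> bool}) (index x (enum (slice a))).
have word_inj i a : {in slice a &, injective (word i a)}.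
  have small x : x \in slice a ->
      (index x (enum (slice a)) < size (enum {ffun 'I_(L i) -> bool}))%N.
    move=> xa; rewrite -cardE card_ffun card_bool card_ord.
    by apply: leq_trans (hL i a); rewrite cardE index_mem mem_enum.
  move=> x y xa ya /eqP; rewrite nth_uniq ?small ?enum_uniq // => /eqP e.
  by have := congr1 (nth x (enum (slice a))) e; rewrite !nth_index ?mem_enum.
pose l (u : G) (p : I) : R :=
  let: (a, j) := tagged p in
  if (u : V) (tag p) == a then (if word _ a u j then 2 else 0) else 1.
apply: (@cubicity_le_card R G I l) => u v uv.
rewrite adj_completeE //; split=> [/forallP h [i [a j]]|h].
  rewrite /l /=; case: eqP => [eu|_]; case: eqP => [ev|_].
  - by have := h i; rewrite eu ev eqxx.
  - by case: (word _ _ _ _); lra.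
  - by case: (word _ _ _ _); lra.
  - by lra.
apply/forallP => i; apply: contraNN uv => /eqP e.
apply/eqP/(word_inj i ((u : V) i)); rewrite ?inE ?e //; apply/ffunP => j.
have := h (Tagged (fun i => ('I_(q i) * 'I_(L i))%type) ((v : V) i, j)).
rewrite /l /= e eqxx.
by case: (word _ _ _ _); case: (word _ _ _ _) => //; lra.
Qed.

Lemma sum_subn2_le_boxicity (R : realType) :
  (forall i, 2 <= q i)%N -> (1 < d)%N ->
  (\sum_(i < d) (q i - 2) <= 2 * boxicity R G)%N.
Proof.
move=> hq d1.
pose S : finType := {i : 'I_d & 'I_(q i - 2)}.
have -> : (\sum_(i < d) (q i - 2))%N = #|S|.
  rewrite card_tagged sumnE big_map big_enum /=.
  by apply: eq_bigr => i _; rewrite card_ord.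
have lt0 i : (0 < q i)%N by apply: leq_trans (hq i).
have lt2 i (a : 'I_(q i - 2)) : (a.+2 < q i)%N by have := ltn_ord a; rewrite ltn_subRL.
(* The values 0 and 1 are kept for the entries of [x] and [y]. *)
pose pt (c : forall i, 'I_(q i)) (s : S) : V := [ffun j =>
  if tag s == j then insubd (c j) (tagged s).+2 else c j].
pose x i : 'I_(q i) := Ordinal (lt0 i).
pose y i : 'I_(q i) := Ordinal (hq i).
(* [insubd] replaces a cast along [tag s = j]; by [lt2] its default is then never taken. *)
have ptE c s j : pt c s j = (if tag s == j then (tagged s).+2 else c j) :> nat.
  rewrite ffunE; case: s => i a /=; case: eqP => // <-.
  by rewrite insubdK // -topredE /= lt2.
(* Entries 0, 1 and those from 2 on are distinct, and two replaced entries at the same [j] agree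
   only if [s = t]. *)
have diff s t j : (s != t) || (tag s != j) -> pt x s j != pt y t j.
  move=> h; rewrite -val_eqE /= !ptE; move: h.
  case: (eqVneq (tag t) j) => [tj|_]; case: (eqVneq (tag s) j) => [sj|_] //=.
  rewrite orbF !eqSS; case: s t sj tj => [i a] [i' b] /= <- e.
  by subst i'; rewrite eq_Tagged.
have uv s : pt x s != pt y s.
  (* The two vertices agree at [tag s], so another coordinate must tell them apart; it exists since
     [1 < d]. *)
  have [j js] : exists j, j \in predC1 (tag s).
    by apply/card_gt0P; rewrite cardC1 card_ord -ltnS prednK // ltnW.
  have h : pt x s j != pt y s j by rewrite diff // eqxx eq_sym.
  by apply/eqP => e; rewrite e eqxx in h.
apply: (@card_le_boxicity R G S (pt x) (pt y)) => // [s|s t st].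
  rewrite (adj_completeE (uv s)); apply/negP => /forallP/(_ (tag s)).
  by rewrite -val_eqE /= !ptE !eqxx.
have d_st j : pt x s j != pt y t j by rewrite diff // st.
rewrite adj_completeE; first exact/forallP.
by apply/eqP => e; have := d_st (tag s); rewrite e eqxx.
Qed.

End CompleteFactors.

(** For [d = 1] the product is complete, of boxicity 0, so the lower bounds fail once its only [q i]
    exceeds 2. The ceiling is the integer length of the words. *)
Theorem theorem9 (R : realType) (d : nat) (q : 'I_d -> nat)
    (hq : forall i, (2 <= q i)%N) :
  let G := direct_prod (fun i => complete_graph (q i)) in
  let n := (\prod_(i < d) q i)%N in
  (((1 < d)%N -> 1 / 2 * \sum_(i < d) ((q i)%:R - 2) <= (boxicity R G)%:R :> R) /\
   (boxicity R G <= \sum_(i < d) q i)%N) /\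
  (((1 < d)%N -> 1 / 2 * \sum_(i < d) ((q i)%:R - 2) <= (cubicity R G)%:R :> R) /\
   (cubicity R G)%:R <=
     \sum_(i < d) (q i)%:R * (Num.ceil (log2 (n%:R / (q i)%:R : R)))%:~R :> R).
Proof.
move=> G n.
have lower : (1 < d)%N ->
    1 / 2 * \sum_(i < d) ((q i)%:R - 2) <= (boxicity R G)%:R :> R.
  move=> d1; have := @sum_subn2_le_boxicity d q R hq d1.
  rewrite -(ler_nat R) natr_sum natrM.
  under eq_bigr => i _ do rewrite natrB //.
  by lra.
split; split=> //; first exact: boxicity_complete_prod_le.
  move=> d1; apply: le_trans (lower d1) _.
  by rewrite ler_nat boxicity_le_cubicity.
have q0 i : (0 < q i)%N by apply: leq_trans (hq i).
have n0 : (0 < n)%N by rewrite prodn_gt0.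
have sliceE i (a : 'I_(q i)) : n%:R / (q i)%:R = #|slice a|%:R :> R.
  by rewrite /n -(card_slice a) natrM mulrAC divff ?mul1r // pnatr_eq0 -lt0n.
have ln2 : 0 < ln 2 :> R by rewrite ln_gt0 // ltr1n.
(* The quotient is the size of a nonempty slice, hence at least 1. *)
have log_ge0 i : 0 <= log2 (n%:R / (q i)%:R : R).
  rewrite (sliceE _ (Ordinal (q0 i))) /log2 divr_ge0 ?(ltW ln2) // ln_ge0 //.
  rewrite ler1n; move: n0; rewrite /n -(card_slice (Ordinal (q0 i))).
  by rewrite muln_gt0 => /andP[].
pose L i : nat := `|Num.ceil (log2 (n%:R / (q i)%:R : R))|%N.
have LE i : Num.ceil (log2 (n%:R / (q i)%:R : R)) = L i.
  by rewrite /L gez0_abs // -(ler_int R) (le_trans (log_ge0 i)) // ceil_ge.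
have -> : \sum_(i < d) (q i)%:R * (Num.ceil (log2 (n%:R / (q i)%:R : R)))%:~R =
    (\sum_(i < d) q i * L i)%:R :> R.
  by rewrite natr_sum; apply: eq_bigr => i _; rewrite LE natrM.
rewrite ler_nat; apply: cubicity_complete_prod_le => i a.
have m0 : (0 < #|slice a|)%N.
  by move: n0; rewrite /n -(card_slice a) muln_gt0 => /andP[].
rewrite -(ler_nat R) natrX -ler_ln ?posrE ?ltr0n ?exprn_gt0 // lnXn //.
rewrite -[ln 2 *+ _]mulr_natl -ler_pdivrMr // -(sliceE i a) -[_ / ln 2]/(log2 _).
have := ceil_ge (log2 (n%:R / (q i)%:R : R)).
by rewrite LE.
Qed.
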